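(* Let $n\ge 1$ and $d\ge 2$ be integers and let $f(x)=g(r(x))$ be a smooth radial function with radial profile $g$. Then $S_nf$ is a radial function with $$(S_nf)(x)=(T_ng)(r(x)),$$ where $$(T_ng)(r)=\sum_{j=0}^{\lfloor n/2\rfloor}\alpha^d_{n,j}\left[(\mathcal{D}^jg)^{(n-2j)}(r)\right]^2,$$ and where $\alpha^d_{n,j}$ are positive integers with $\alpha^d_{n,0}=1$ and $$\alpha^d_{n,j}=\binom{n}{2j}\cdot(2j-1)!!\cdot\prod_{k=0}^{j-1}(d-1+2k),\qquad 1\le j\le\lfloor n/2\rfloor.$$
   Context: For $x\in\mathbb{R}^d$, $r(x)=\sqrt{x_1^2+\dots+x_d^2}$. $B_R$ is the open ball in $\mathbb{R}^d$ centered at the origin with radius $R\in(0,\infty]$ ($B_\infty=\mathbb{R}^d$). A radial function on $B_R$ is one of the form $f(x)=g(r(x))$; its radial profile is $g(t)=f(t\mathbf{e}_1)$, $t\in(-R,R)$, where $\mathbf{e}_1$ is the first canonical basis vector. If $f$ is smooth (i.e. $C^\infty$), then $g$ is smooth and even. For a sufficiently smooth function $f$, $$(S_nf)(x)=\|\nabla^nf(x)\|_F^2=\sum_{i_1,\dots,i_n=1}^d\Bigl(\frac{\partial^nf(x)}{\partial x_{i_1}\cdots\partial x_{i_n}}\Bigr)^2$$ is the squared Frobenius norm of the tensor of all $n$-th order partial derivatives. The operator $\mathcal{D}$ is $\mathcal{D}g(r)=g'(r)/r$; $\mathcal{D}^j$ is its $j$-fold iteration ($\mathcal{D}^0g=g$),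 and $(\cdot)^{(m)}$ is the $m$-th ordinary derivative. For smooth even $g$, $\mathcal{D}g$ is understood at $r=0$ as its unique continuous extension, so that $\mathcal{D}^jg$ is again smooth and even. The double factorial is $(2j-1)!!=1\cdot3\cdots(2j-1)$. *)

(* Defs.v *)
From HB Require Import structures.
From mathcomp Require Import all_boot all_order all_algebra.
From mathcomp Require Import all_classical all_reals all_analysis.

Set Implicit Arguments.
Unset Strict Implicit.
Unset Printing Implicit Defensive.

Import Order.TTheory GRing.Theory Num.Theory.
Import numFieldNormedType.Exports.

Local Open Scope ring_scope.
Local Open Scope classical_set_scope.

(* The library norm `|x| on 'rV[R]_d is the max norm, hence this definition. *)
Definition enorm (R : realType) (d : nat) (x : 'rV[R]_d) : R :=
  Num.sqrt (\sum_(i < d) x 0 i ^+ 2).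

Definition eball (R : realType) (d : nat) (rho : \bar R) : set 'rV[R]_d :=
  [set x | ((enorm x)%:E < rho)%E].

(* Written with a test on the index so that it makes sense for every d; it is
   the first canonical basis vector when 0 < d. *)
Definition e1 (R : realType) (d : nat) : 'rV[R]_d :=
  \row_(j < d) (val j == 0)%N%:R.

(* partials [:: i_1; ...; i_n] f is d/dx_(i_1) (... (d/dx_(i_n) f)). *)
Definition partials (R : realType) (d : nat) (s : seq 'I_d)
    (f : 'rV[R]_d -> R) : 'rV[R]_d -> R :=
  foldr (fun i h => 'D_(delta_mx 0 i) h) f s.

(* The values of f outside the open ball are irrelevant, here and below. *)
Definition smooth_on_ball (R : realType) (d : nat) (rho : \bar R)
    (f : 'rV[R]_d -> R) : Prop :=
  forall (s : seq 'I_d) (x : 'rV[R]_d), eball rho x ->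
    {for x, continuous (partials s f)} /\
    (forall i : 'I_d, derivable (partials s f) x (delta_mx 0 i)).

Definition radial_on_ball (R : realType) (d : nat) (rho : \bar R)
    (f : 'rV[R]_d -> R) : Prop :=
  exists h : R -> R, forall x, eball rho x -> f x = h (enorm x).

Definition radial_profile (R : realType) (d : nat) (rho : \bar R)
    (f : 'rV[R]_d -> R) (g : R -> R) : Prop :=
  forall t : R, (`|t|%:E < rho)%E -> g t = f (t *: e1 R d).

Definition S_op (R : realType) (d n : nat) (f : 'rV[R]_d -> R)
    (x : 'rV[R]_d) : R :=
  \sum_(s : n.-tuple 'I_d) (partials s f x) ^+ 2.

(* At 0 the value is the limit along the punctured neighbourhoods of 0. *)
Definition D_op (R : realType) (g : R -> R) (r : R) : R :=
  if r == 0 then lim ((derive1 g t / t) @[t --> 0^']) else derive1 g r / r.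

(* odd_dfact j is (2j-1)!!, the empty product 1 for j = 0. *)
Definition odd_dfact (j : nat) : nat := (\prod_(i < j) (2 * i + 1))%N.

Definition alpha (d n j : nat) : nat :=
  ('C(n, 2 * j) * odd_dfact j * \prod_(k < j) (d - 1 + 2 * k))%N.

Definition T_op (R : realType) (d n : nat) (g : R -> R) (r : R) : R :=
  \sum_(j < n./2.+1)
    (alpha d n j)%:R * (derive1n (n - 2 * j) (iter j (@D_op R) g) r) ^+ 2.

(* Main.v *)
Require Import Defs.
From HB Require Import structures.
From mathcomp Require Import all_boot all_order all_algebra.
From mathcomp Require Import all_classical all_reals all_analysis.
From mathcomp Require Import ring zify.
Import Order.TTheory GRing.Theory Num.Theory.
Import numFieldNormedType.Exports.
Local Open Scope ring_scope.
Local Open Scope classical_set_scope.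

Set Implicit Arguments.
Unset Strict Implicit.
Unset Printing Implicit Defensive.

(** Both sides are invariant under rotations, so the identity only has to be
    checked on a coordinate axis, where every partial derivative of [f] turns
    out to be an integer multiple of one of the functions [(D^j g)^(n-2j)]; the
    coefficients [alpha] then come from counting.

    Away from the origin, [f = g o r], and the derivative of [D^k g o r] along
    [x_i] is [x_i (D^(k+1) g o r)].  If a formal variable [X] records the
    exponent of [D], differentiation along [x_i] becomes
    [p |-> X x_i p + dp/dx_i] on polynomials in [X] whose coefficients are
    functions of [x].  Started from [1], it produces a product over the
    coordinates of Hermite polynomials [H_c(x_i)], where [c] counts the
    occurrences of [i] among the differentiated indices ([partials_radial]).
    The same computation along an arbitrary vector [v] shows that [D_v] of a
    partial derivative is the combination of the next ones with coefficients
    [v_i] ([is_derive_partials]); being linear in [v], these derivatives obey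
    the chain rule for an orthogonal change of variables ([partials_rotate]).  As
    tensor powers of an orthogonal matrix are orthogonal, [S_n f x] is equal to
    [S_n f] at the point of norm [r(x)] of an axis ([S_op_axis]).

    At a point [t e] of the axis, all coordinates but one vanish, and [H_c(0)]
    is [(c-1)!! X^(c/2)] for even [c] and [0] for odd [c]; hence only words in
    which every other index occurs an even number of times contribute
    ([partials_axis_neq0]).  Since [d >= 2], a second index is available, and
    [D^j g (t)] is [1/(2j-1)!!] times the derivative of order [2j] of [f] in
    that direction at [t e] ([iter_D_op_partials]).  This derivative is
    continuous in [t], so that it also computes the limits by which
    [D^j g (0)] is defined, and the formulas extend to the origin.

    It remains to sum the squares of the products of double factorials over the
    words of length [n] containing the axis index [n - 2j] times.  Marking an
    occurrence of a letter ([sum_counts_mul]) yields two recurrences, which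
    [alpha] satisfies as well ([sum_weight_alpha]). *)

(** * Counting words with weights *)

Definition counts d (s : seq 'I_d) : 'I_d -> nat := fun i => count_mem i s.

Definition incr d (i : 'I_d) (c : 'I_d -> nat) : 'I_d -> nat :=
  fun k => ((i == k) + c k)%N.

Lemma big_tuple_cons (T : Type) (idx : T) (op : Monoid.com_law idx) d n
    (F : seq 'I_d -> T) :
  \big[op/idx]_(s : n.+1.-tuple 'I_d) F s =
  \big[op/idx]_(i < d) \big[op/idx]_(s : n.-tuple 'I_d) F (i :: s).
Proof.
rewrite pair_big /=.
rewrite (reindex (fun p : 'I_d * n.-tuple 'I_d => [tuple of p.1 :: p.2])) //=.
exists (fun s : n.+1.-tuple 'I_d => (thead s, [tuple of behead s])).
  move=> [i s] _ /=; congr (_, _); exact/val_inj.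
move=> s _ /=.
by rewrite [RHS]tuple_eta.
Qed.

Lemma big_tuple0 (T : Type) (idx : T) (op : Monoid.com_law idx) d
    (F : seq 'I_d -> T) :
  \big[op/idx]_(s : 0.-tuple 'I_d) F s = F [::].
Proof.
by rewrite (big_pred1 [tuple]) // => s; apply/esym/eqP; rewrite [s]tuple0.
Qed.

Lemma sum_incr d (i : 'I_d) c :
  (\sum_(k < d) incr i c k = (\sum_(k < d) c k).+1)%N.
Proof.
rewrite /incr big_split /= (bigD1 i) //= eqxx big1 // => k.
by rewrite eq_sym => /negbTE ->.
Qed.

Lemma sum_counts d (s : seq 'I_d) : (\sum_(i < d) counts s i)%N = size s.
Proof. by elim: s => [|j s IH]; [rewrite big1 | rewrite sum_incr IH]. Qed.

Section MatchingCounts.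
Local Open Scope nat_scope.

(** Double counting: a word of length [n+1] with a marked occurrence of [i] is
    a word of length [n] with an extra [i] inserted at one of [n+1] places, and
    the place is invisible to [phi].  The induction peels the first letter. *)
Lemma sum_counts_mul d (i : 'I_d) n (phi : ('I_d -> nat) -> nat) :
  \sum_(s : n.+1.-tuple 'I_d) counts s i * phi (counts s) =
  n.+1 * \sum_(s : n.-tuple 'I_d) phi (incr i (counts s)).
Proof.
have head m psi : \sum_(s : m.+1.-tuple 'I_d) counts s i * psi (counts s) =
    \sum_(s : m.-tuple 'I_d) psi (incr i (counts s)) +
    \sum_(j < d) \sum_(s : m.-tuple 'I_d)
       counts s i * psi (incr j (counts s)).
  rewrite (@big_tuple_cons _ _ addn _ _ (fun s => counts s i * psi (counts s))).
  under eq_bigr => j _ do under eq_bigr => s _ do rewrite [counts _ i]/= mulnDl.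
  under eq_bigr => j _ do rewrite big_split /=.
  rewrite big_split /=; congr (_ + _).
  rewrite (bigD1 i) //= [X in _ + X]big1 ?addn0 => [|j /negbTE ji].
    by apply: eq_bigr => s _; rewrite eqxx mul1n.
  by rewrite big1 // => s _; rewrite ji mul0n.
elim: n phi => [|n IH] phi; rewrite head.
  rewrite mul1n [X in _ + X]big1 ?addn0 // => j _.
  exact: (@big_tuple0 _ _ addn _
    (fun s => counts s i * phi (incr j (counts s)))).
rewrite mulSn; congr (_ + _).
under eq_bigr => j _ do rewrite (IH (fun c => phi (incr j c))).
rewrite -big_distrr /=; congr (_ * _).
rewrite [RHS](@big_tuple_cons _ _ addn _ _ (fun s => phi (incr i (counts s)))).
apply: eq_bigr => j _; apply: eq_bigr => s _; congr phi.
by apply/funext => k; rewrite /incr /= addnCA.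
Qed.

(** The number of perfect matchings of [c] points: it is the value at [0] of the
    derivative of order [c] of [exp (x^2/2)], which is how it enters here. *)
Definition matchings (c : nat) : nat := if odd c then 0 else odd_dfact c./2.

Lemma matchingsSS c : matchings c.+2 = c.+1 * matchings c.
Proof.
rewrite /matchings /= negbK; case: ifP => [|/negbT oc]; first by rewrite muln0.
rewrite /odd_dfact big_ord_recr /= mulnC; congr (_ * _).
by move: oc; rewrite -dvdn2; lia.
Qed.

(** The index [i0] is the axis direction, whose coordinate is not set to [0]. *)
Definition weight d (i0 : 'I_d) (c : 'I_d -> nat) : nat :=
  \prod_(i < d | i != i0) matchings (c i).

Definition sum_weight d (i0 : 'I_d) (n m : nat) : nat :=
  \sum_(s : n.-tuple 'I_d) (counts s i0 == m) * weight i0 (counts s) ^ 2.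

Lemma weight_incr0 d (i0 : 'I_d) c : weight i0 (incr i0 c) = weight i0 c.
Proof.
apply: eq_bigr => i; rewrite eq_sym => /negbTE ne; congr matchings.
by rewrite /incr ne.
Qed.

(** Marking an occurrence of [i0] in a word that has [m+1] of them. *)
Lemma sum_weight_recr d (i0 : 'I_d) n m :
  m.+1 * sum_weight i0 n.+1 m.+1 = n.+1 * sum_weight i0 n m.
Proof.
have := sum_counts_mul i0 n
  (fun c => (c i0 == m.+1) * weight i0 c ^ 2).
rewrite /sum_weight => H; rewrite big_distrr /=.
transitivity (\sum_(s : n.+1.-tuple 'I_d)
    counts s i0 * ((counts s i0 == m.+1) * weight i0 (counts s) ^ 2)).
  by apply: eq_bigr => s _; case: eqP => [->//|_]; rewrite !mul0n !muln0.
rewrite H; congr (_ * _); apply: eq_bigr => s _.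
by rewrite weight_incr0 /incr eqxx.
Qed.

Lemma sum_weight_bin d (i0 : 'I_d) n m :
  sum_weight i0 (n + m) m = 'C(n + m, m) * sum_weight i0 n 0.
Proof.
elim: m => [|m IH]; first by rewrite addn0 bin0 mul1n.
apply/eqP; rewrite -(eqn_pmul2l (ltn0Sn m)) addnS sum_weight_recr IH.
by rewrite !mulnA mul_bin_diag.
Qed.

(** In a word without [i0], let [i] be the first letter and [c] the number of
    occurrences of [i] in the rest.  The factor of [i] in the squared weight is
    [matchings c.+1 ^ 2 = c ^ 2 * matchings c.-1 ^ 2].  One of the factors [c]
    marks an occurrence of [i] in the rest, and removing both letters [i] leaves
    a word of length [n], counted [n.+1] times, with its squared weight and the
    remaining factor [c], which is one more than its number of letters [i].
    These factors add up to [n + (d - 1)] over [i <> i0]. *)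
Lemma sum_weight0SS d (i0 : 'I_d) n :
  sum_weight i0 n.+2 0 = n.+1 * (n + d.-1) * sum_weight i0 n 0.
Proof.
rewrite {1}/sum_weight.
rewrite (@big_tuple_cons _ _ addn _ _
  (fun s => (counts s i0 == 0) * weight i0 (counts s) ^ 2)) /=.
rewrite (bigD1 i0) //= big1 ?add0n => [|s _]; last by rewrite eqxx.
pose phi i c := (c i0 == 0) *
  (c i * (matchings (c i).-1 *
     \prod_(k < d | (k != i0) && (k != i)) matchings (c k)) ^ 2).
transitivity (\sum_(i < d | i != i0) \sum_(s : n.+1.-tuple 'I_d)
    counts s i * phi i (counts s)).
  apply: eq_bigr => i ne; apply: eq_bigr => s _.
  rewrite /phi (negbTE ne) add0n [RHS]mulnCA; congr (_ * _).
  rewrite /weight (bigD1 i) //= eqxx add1n.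
  rewrite (eq_bigr (fun k => matchings (counts s k))); last first.
    by move=> k /andP[_]; rewrite eq_sym => /negbTE ->.
  move: (\prod_(_ < _ | _) _) => p; rewrite -/(counts s i).
  by case: (counts s i) => [|c] //=; rewrite matchingsSS; ring.
under eq_bigr => i _ do rewrite sum_counts_mul.
rewrite -big_distrr /= -mulnA; congr (_ * _).
rewrite exchange_big /sum_weight big_distrr /=; apply: eq_bigr => s _.
transitivity (\sum_(i < d | i != i0)
    (counts s i0 == 0) * (weight i0 (counts s) ^ 2 * (counts s i).+1)).
  apply: eq_bigr => i ne; rewrite /phi /incr eqxx (negbTE ne) add0n add1n /=.
  congr (_ * _); rewrite mulnC; congr (_ ^ 2 * _).
  rewrite /weight [RHS](bigD1 i) //=; congr (_ * _).
  by apply: eq_bigr => k /andP[_]; rewrite eq_sym => /negbTE ->.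
rewrite -!big_distrr /= [RHS]mulnCA.
have [c0|_] := eqVneq (counts s i0) 0; last by rewrite !mul0n.
rewrite !mul1n mulnC; congr (_ * _).
under eq_bigr => i _ do rewrite -addn1.
rewrite big_split /= sum1_card cardC1 card_ord; congr (_ + _).
by rewrite -[RHS](size_tuple s) -sum_counts [RHS](bigD1 i0) //= c0.
Qed.

Lemma sum_weight0 d (i0 : 'I_d) j :
  sum_weight i0 (2 * j) 0 = odd_dfact j * \prod_(k < j) (d - 1 + 2 * k).
Proof.
elim: j => [|j IH].
  rewrite muln0 /sum_weight (@big_tuple0 _ _ addn _
    (fun s => (counts s i0 == 0) * weight i0 (counts s) ^ 2)).
  rewrite /weight big1 => [|i _]; first by rewrite /odd_dfact !big_ord0.
  by rewrite /matchings /odd_dfact big_ord0.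
rewrite mulnS sum_weight0SS IH /odd_dfact !big_ord_recr /=.
by rewrite subn1; ring.
Qed.

Lemma sum_weight_alpha d (i0 : 'I_d) n j : j <= n./2 ->
  sum_weight i0 n (n - 2 * j) = alpha d n j.
Proof.
move=> jn; have le2 : 2 * j <= n by lia.
have := sum_weight_bin i0 (2 * j) (n - 2 * j).
by rewrite subnKC // => ->; rewrite bin_sub // sum_weight0 mulnA.
Qed.

End MatchingCounts.

(** * Hermite polynomials with a formal variable for [D] *)

Section Hermite.
Variable R : realType.

(** [hermite x a] is [exp (- X x^2/2) * (d/dx)^a (exp (X x^2/2))], a rescaled
    Hermite polynomial in which the formal variable ['X] stands for [D]. *)
Fixpoint hermite (x : R) (a : nat) : {poly R} :=
  if a is b.+1 then
    if b is c.+1 then 'X * (x *: hermite x b + b%:R *: hermite x c)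
    else x *: 'X
  else 1.

Lemma hermiteS x a :
  hermite x a.+1 = 'X * (x *: hermite x a + a%:R *: hermite x a.-1).
Proof. by case: a => //=; rewrite scale0r addr0 -scalerAr mulr1. Qed.

Lemma hermite_at0 a : hermite 0 a = (matchings a)%:R *: 'X^(a./2).
Proof.
elim/ltn_ind: a => -[|[|a]] IH.
- by rewrite /matchings /odd_dfact big_ord0 scale1r expr0.
- by rewrite /= !scale0r.
- rewrite hermiteS scale0r add0r IH // matchingsSS /= natrM.
  by rewrite exprS scalerA -scalerAr.
Qed.

Lemma size_hermite x a : (size (hermite x a) <= a.+1)%N.
Proof.
elim/ltn_ind: a => -[|[|a]] IH; first by rewrite size_poly1.
  by rewrite (leq_trans (size_scale_leq _ _)) // size_polyX.
rewrite hermiteS mulrC; apply: leq_trans (size_polyMleq _ _) _.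
rewrite size_polyX addn2 /= ltnS; apply: leq_trans (size_polyD _ _) _.
rewrite geq_max !(leq_trans (size_scale_leq _ _)) //; first exact: IH.
exact: leq_trans (IH _ _) _.
Qed.

(** The linear form that interprets the monomial ['X^k] as the number [phi k];
    it is used with [phi k = (D^k g)(r(x))]. *)
Definition pairing (p : {poly R}) (phi : nat -> R) : R :=
  \sum_(k < size p) p`_k * phi k.

Lemma pairing_wide n (p : {poly R}) phi : (size p <= n)%N ->
  pairing p phi = \sum_(k < n) p`_k * phi k.
Proof.
move=> le; rewrite /pairing (big_ord_widen n (fun k => p`_k * phi k)) //.
rewrite big_mkcond /=; apply: eq_bigr => k _.
by case: ltnP => // ge; rewrite nth_default ?mul0r.
Qed.

Lemma pairingD p q phi : pairing (p + q) phi = pairing p phi + pairing q phi.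
Proof.
rewrite !(@pairing_wide (maxn (size p) (size q)));
  rewrite ?leq_maxl ?leq_maxr ?size_polyD //.
by rewrite -big_split /=; apply: eq_bigr => k _; rewrite coefD mulrDl.
Qed.

Lemma pairingZ a p phi : pairing (a *: p) phi = a * pairing p phi.
Proof.
rewrite !(@pairing_wide (size p)) ?size_scale_leq // mulr_sumr.
by apply: eq_bigr => k _; rewrite coefZ mulrA.
Qed.

Lemma pairing0 phi : pairing 0 phi = 0.
Proof. by rewrite /pairing size_poly0 big_ord0. Qed.

Lemma pairing_sum (I : Type) (r : seq I) (P : pred I) (F : I -> {poly R}) phi :
  pairing (\sum_(i <- r | P i) F i) phi = \sum_(i <- r | P i) pairing (F i) phi.
Proof.
apply: (big_morph (pairing^~ phi)) => [p q|]; first exact: pairingD.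
exact: pairing0.
Qed.

Lemma pairingXM p phi : pairing ('X * p) phi = pairing p (fun k => phi k.+1).
Proof.
rewrite mulrC (@pairing_wide (size p).+1); last first.
  by apply: leq_trans (size_polyMleq _ _) _; rewrite size_polyX addn2.
rewrite big_ord_recl coefMX eqxx mul0r add0r /pairing.
by apply: eq_bigr => k _; rewrite coefMX.
Qed.

Lemma pairingXn k phi : pairing 'X^k phi = phi k.
Proof.
rewrite /pairing size_polyXn big_ord_recr /= coefXn eqxx mul1r big1 ?add0r //.
by move=> i _; rewrite coefXn ltn_eqF // mul0r.
Qed.

Section Derivative.
Variables (V : normedModType R) (x v : V).

Definition is_pderive (P : V -> {poly R}) (dP : {poly R}) : Prop :=
  forall k, is_derive x v (fun y => (P y)`_k) dP`_k.

Lemma is_pderive_cst p : is_pderive (fun=> p) 0.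
Proof. by move=> k; rewrite coef0; exact: is_derive_cst. Qed.

Lemma is_pderiveD P Q dP dQ : is_pderive P dP -> is_pderive Q dQ ->
  is_pderive (fun y => P y + Q y) (dP + dQ).
Proof.
move=> hP hQ k; rewrite coefD.
under eq_fun do rewrite coefD.
exact: is_deriveD.
Qed.

Lemma is_pderiveM P Q dP dQ : is_pderive P dP -> is_pderive Q dQ ->
  is_pderive (fun y => P y * Q y) (dP * Q x + P x * dQ).
Proof.
move=> hP hQ k; under eq_fun do rewrite coefM.
have H (i : 'I_k.+1) := @is_deriveM _ _ _ _ x v _ _ (hP i) (hQ (k - i)%N).
have := is_derive_sum H; rewrite fct_sumE => /is_derive_eq; apply.
rewrite coefD !coefM -big_split /=; apply: eq_bigr => i _.
by rewrite addrC /GRing.scale /= [X in _ + X]mulrC.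
Qed.

Lemma is_pderiveZ (u : V -> R) (du : R) P dP :
  is_derive x v u du -> is_pderive P dP ->
  is_pderive (fun y => u y *: P y) (du *: P x + u x *: dP).
Proof.
move=> hu hP k; under eq_fun do rewrite coefZ.
have /is_derive_eq := @is_deriveM _ _ _ _ x v _ _ hu (hP k); apply.
by rewrite coefD !coefZ addrC /GRing.scale /= [X in X + _ = _]mulrC.
Qed.

Lemma is_pderive_prod (I : eqType) (r : seq I) (P : I -> V -> {poly R}) dP :
  uniq r -> (forall i, is_pderive (P i) (dP i)) ->
  is_pderive (fun y => \prod_(i <- r) P i y)
    (\sum_(i <- r) dP i * \prod_(k <- r | k != i) P k x).
Proof.
move=> + hP; elim: r => [_|i r IH /andP[ir ur]].
  by under eq_fun do rewrite big_nil; rewrite big_nil; exact: is_pderive_cst.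
under eq_fun do rewrite big_cons.
have := is_pderiveM (hP i) (IH ur); congr is_pderive.
rewrite big_cons big_cons eqxx /= mulr_sumr; congr (_ * _ + _).
  rewrite [RHS]big_seq_cond [LHS]big_seq; apply: eq_bigl => k.
  by case: (k \in r) (memPn ir k) => //= ->.
rewrite !big_seq; apply: eq_bigr => k kr.
by rewrite big_cons eq_sym (memPn ir k kr) mulrCA.
Qed.

(** The Appell property [H_a' = a X H_(a-1)] of Hermite polynomials; with the
    recurrence that defines them, it makes [X x + d/dx] raise the degree by
    one. *)
Lemma is_pderive_hermite (u : V -> R) (du : R) a : is_derive x v u du ->
  is_pderive (fun y => hermite (u y) a)
    (du *: (a%:R *: ('X * hermite (u x) a.-1))).
Proof.
move=> hu; elim/ltn_ind: a => -[|a] IH.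
  by rewrite scale0r scaler0; exact: is_pderive_cst.
under eq_fun do rewrite hermiteS.
have h1 := is_pderiveZ hu (IH _ (leqnn _)).
have h2 : is_pderive (fun y => a%:R *: hermite (u y) a.-1)
    (a%:R *: (du *: (a.-1%:R *: ('X * hermite (u x) a.-2)))).
  case: a IH {h1} => [|a] IH.
    by rewrite scale0r; under eq_fun do rewrite scale0r; exact: is_pderive_cst.
  have := is_pderiveZ (is_derive_cst (a.+1%:R : R) x v) (IH a (ltnW (leqnn _))).
  by rewrite scale0r add0r.
have := is_pderiveM (is_pderive_cst 'X) (is_pderiveD h1 h2).
congr is_pderive; rewrite mul0r add0r /=.
case: a {IH h1 h2} => [|a].
  by rewrite /= !scale0r !scaler0 !addr0 !scale1r -scalerAr.
rewrite hermiteS /= -!mul_polyC -(@natr1 _ a.+1) !polyCD !polyC1; ring.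
Qed.

(** The bound [n] on the sizes makes the pairing a sum with a fixed number of
    terms, which can be differentiated term by term. *)
Lemma is_derive_pairing n (P : V -> {poly R}) dP (F : V -> nat -> R) delta :
  (forall y, (size (P y) <= n)%N) -> is_pderive P dP ->
  (forall k, is_derive x v (fun y => F y k) (delta * F x k.+1)) ->
  is_derive x v (fun y => pairing (P y) (F y))
    (pairing dP (F x) + delta * pairing ('X * P x) (F x)).
Proof.
move=> sP hP hF.
have sdP : (size dP <= n)%N.
  apply/leq_sizeP => k nk; rewrite -[dP`_k](@derive_val _ _ _ _ _ _ _ (hP k)).
  have -> : (fun y => (P y)`_k) = cst 0.
    by apply/funext => y; rewrite nth_default // (leq_trans (sP y)).
  by rewrite derive_val.
under eq_fun => y do rewrite (pairing_wide _ (sP y)).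
have H (i : 'I_n) := @is_deriveM _ _ _ _ x v _ _ (hP i) (hF i).
have := is_derive_sum H; rewrite fct_sumE => /is_derive_eq; apply.
rewrite pairingXM (pairing_wide _ sdP) (pairing_wide _ (sP x)).
rewrite mulr_sumr -big_split /=; apply: eq_bigr => i _.
rewrite /GRing.scale /=; ring.
Qed.
End Derivative.

Lemma is_derive_coord d (x v : 'rV[R]_d) i :
  is_derive x v (fun y : 'rV[R]_d => y 0 i) (v 0 i).
Proof.
have dc := @diff_derivable _ _ _ _ _ v (@differentiable_coord R 1 d x 0 i).
apply: DeriveDef => //.
have := @derive_mx _ _ _ _ id x v.
rewrite derive_id => /(_ (@derivable_id _ _ _ _)).
by move=> /matrixP /(_ 0 i); rewrite mxE => <-.
Qed.

(** The operator [X x_i + d/dx_i] raises the index of the factor [i] of the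
    product; the direction [v] is arbitrary, so that this also gives the
    linearity of the directional derivative in [v]. *)
Lemma is_derive_hermite_prod d (x v : 'rV[R]_d) (c : 'I_d -> nat)
    (F : 'rV[R]_d -> nat -> R) :
  (forall k, is_derive x v (fun y => F y k)
     ((\sum_(i < d) v 0 i * x 0 i) * F x k.+1)) ->
  is_derive x v (fun y => pairing (\prod_(i < d) hermite (y 0 i) (c i)) (F y))
    (\sum_(i < d)
       v 0 i * pairing (\prod_(k < d) hermite (x 0 k) (incr i c k)) (F x)).
Proof.
move=> hF.
have hH i := is_pderive_hermite (c i) (is_derive_coord x v i).
have hP := is_pderive_prod (index_enum_uniq _) hH.
have sP (y : 'rV[R]_d) : (size (\prod_(i < d) hermite (y 0 i) (c i))%R <=
    (\sum_(i < d) (c i).+1).+1)%N.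
  apply: leq_trans (size_poly_prod_leq _ _) _.
  apply: leq_trans (leq_subr _ _) _; rewrite ltnS.
  by apply: leq_sum => i _; exact: size_hermite.
have := is_derive_pairing sP hP hF => /is_derive_eq; apply.
rewrite pairing_sum mulr_suml -big_split /=; apply: eq_bigr => i _.
rewrite -scalerAl pairingZ -mulrA -mulrDr; congr (_ * _).
rewrite -pairingZ -pairingD; congr pairing.
rewrite [in RHS](bigD1 i) //=.
rewrite [\prod_(k < d) hermite (x 0 k) (c k)](bigD1 i) //= /incr eqxx add1n.
rewrite [in RHS](eq_bigr (fun k => hermite (x 0 k) (c k))) => [|k]; last first.
  by rewrite eq_sym => /negbTE ->.
rewrite hermiteS -!mul_polyC; ring.
Qed.
End Hermite.

(** * Orthogonal matrices and sums of squares *)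

Section Rotation.
Variables (R : realType) (d : nat).

Lemma enorm_sqr (x : 'rV[R]_d) : enorm x ^+ 2 = \sum_(i < d) x 0 i ^+ 2.
Proof. by rewrite sqr_sqrtr // sumr_ge0 // => i _; rewrite sqr_ge0. Qed.

Lemma enorm_ge0 (x : 'rV[R]_d) : 0 <= enorm x.
Proof. exact: sqrtr_ge0. Qed.

Lemma mulmx_tr_enorm (x : 'rV[R]_d) : x *m x^T = (enorm x ^+ 2)%:M.
Proof.
rewrite [LHS]mx11_scalar enorm_sqr mxE; congr (_%:M).
by apply: eq_bigr => i _; rewrite mxE.
Qed.

Lemma enorm_eq0 (x : 'rV[R]_d) : (enorm x == 0) = (x == 0).
Proof.
apply/idP/eqP => [|->]; last first.
  by rewrite /enorm big1 ?sqrtr0 // => i _; rewrite mxE expr0n.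
rewrite -sqrf_eq0 enorm_sqr psumr_eq0 => [|i _]; last exact: sqr_ge0.
move=> /allP h; apply/rowP => i; rewrite mxE; apply/eqP.
by rewrite -sqrf_eq0; apply: h; rewrite mem_index_enum.
Qed.

Lemma enorm_axis (t : R) (i : 'I_d) :
  enorm (t *: (delta_mx 0 i : 'rV[R]_d)) = `|t|.
Proof.
rewrite /enorm (bigD1 i) //= big1 ?addr0 => [|k /negbTE ki].
  by rewrite !mxE !eqxx mulr1 sqrtr_sqr.
by rewrite !mxE ki andbF mulr0 expr0n.
Qed.

Lemma enorm_orthogonal (Q : 'M[R]_d) (x : 'rV[R]_d) :
  Q^T *m Q = 1%:M -> enorm (x *m Q) = enorm x.
Proof.
move=> /mulmx1C QQ; apply/eqP.
rewrite -(eqrXn2 (ltn0Sn 1)) ?enorm_ge0 //; apply/eqP.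
have := mulmx_tr_enorm (x *m Q).
rewrite trmx_mul -mulmxA (mulmxA Q) QQ mul1mx mulmx_tr_enorm.
by move=> /matrixP /(_ 0 0); rewrite !mxE !mulr1n.
Qed.

(** The Householder reflection that exchanges [x] and [enorm x *: e]. *)
Lemma orthogonal_to_axis (x : 'rV[R]_d) (i0 : 'I_d) :
  exists2 Q : 'M[R]_d, Q^T *m Q = 1%:M & x *m Q = enorm x *: delta_mx 0 i0.
Proof.
set e := delta_mx 0 i0; pose v := x - enorm x *: e.
have [v0|vn0] := eqVneq v 0.
  exists 1%:M; first by rewrite trmx1 mul1mx.
  by rewrite mulmx1; apply/eqP; rewrite -subr_eq0 -/v v0.
pose N := enorm v ^+ 2.
have Nn0 : N != 0 by rewrite sqrf_eq0 enorm_eq0.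
have vv : v *m v^T = N%:M by exact: mulmx_tr_enorm.
(* [x] and [enorm x *: e] have the same norm, so [x . v] is half of [v . v]. *)
have xv : x *m v^T = (N / 2)%:M.
  have xx := mulmx_tr_enorm x.
  have ee : e *m e^T = 1%:M.
    by rewrite mulmx_tr_enorm -[e]scale1r enorm_axis normr1 expr1n.
  have ex : e *m x^T = x *m e^T.
    rewrite -[RHS]trmxK trmx_mul trmxK.
    by apply/matrixP => i j; rewrite !ord1 [RHS]mxE.
  have : N%:M = x *m v^T *+ 2.
    rewrite -vv {1}/v mulmxBl -scalemxAl.
    rewrite /v !linearB /= !linearZ /= xx ee ex.
    apply/matrixP => i j; rewrite !mxE.
    by rewrite !ord1 /= !mulr1n; ring.
  have two0 : (2 : R) != 0 by rewrite pnatr_eq0.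
  move=> H; apply: (scalerI two0).
  by rewrite scaler_nat -H scale_scalar_mx mulrC divfK.
pose Q : 'M[R]_d := 1%:M - (2 / N) *: (v^T *m v).
have tQ : Q^T = Q by rewrite /Q linearB /= linearZ /= trmx1 trmx_mul trmxK.
exists Q.
  have ww : (v^T *m v) *m (v^T *m v) = N *: (v^T *m v).
    by rewrite -mulmxA (mulmxA v) vv mul_scalar_mx -scalemxAr.
  rewrite tQ /Q; set w := v^T *m v in ww *.
  rewrite mulmxBl mul1mx mulmxBr mulmx1 -scalemxAl -scalemxAr ww !scalerA.
  have -> : 2 / N * (2 / N) * N = 2 / N + 2 / N by field.
  by rewrite scalerDl; apply/matrixP => i j; rewrite !mxE; ring.
rewrite /Q mulmxBr mulmx1 -scalemxAr mulmxA xv mul_scalar_mx scalerA.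
have -> : 2 / N * (N / 2) = 1 by field.
by rewrite scale1r /v subKr.
Qed.

(** Entry [(s, s')] of the tensor power of [Q] of order [size s]. *)
Fixpoint tensor_pow (Q : 'M[R]_d) (s s' : seq 'I_d) : R :=
  if (s, s') is (i :: t, k :: t') then Q i k * tensor_pow Q t t' else 1.

Lemma sum_sqr_orthogonal (Q : 'M[R]_d) (a : 'I_d -> R) :
  Q^T *m Q = 1%:M ->
  \sum_(i < d) (\sum_(k < d) Q i k * a k) ^+ 2 = \sum_(k < d) a k ^+ 2.
Proof.
move=> /(congr1 trmx); rewrite trmx_mul trmxK trmx1 => QQ.
have := @enorm_orthogonal Q^T (\row_k a k); rewrite trmxK.
move=> /(_ (mulmx1C QQ)) /(congr1 (fun r => r ^+ 2)); rewrite !enorm_sqr.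
under [X in _ = X -> _]eq_bigr => k _ do rewrite mxE.
move=> <-; apply: eq_bigr => i _; congr (_ ^+ 2); rewrite mxE.
by apply: eq_bigr => k _; rewrite !mxE mulrC.
Qed.

(** The tensor powers of an orthogonal matrix preserve the Frobenius norm; the
    first index is split off and the two orthogonalities are used in turn. *)
Lemma sum_sqr_tensor_pow (Q : 'M[R]_d) n (u : seq 'I_d -> R) :
  Q^T *m Q = 1%:M ->
  \sum_(s : n.-tuple 'I_d)
     (\sum_(s' : n.-tuple 'I_d) tensor_pow Q s s' * u s') ^+ 2 =
  \sum_(s : n.-tuple 'I_d) u s ^+ 2.
Proof.
move=> QQ; elim: n u => [|n IH] u.
  rewrite (big_tuple0 _
    (fun s => (\sum_(s' : 0.-tuple _) tensor_pow Q s s' * _) ^+ 2)).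
  rewrite (big_tuple0 _ (fun s' => tensor_pow Q [::] s' * u s')).
  by rewrite (big_tuple0 _ (fun s => u s ^+ 2)) mul1r.
rewrite (big_tuple_cons _ _
  (fun s => (\sum_(s' : _.-tuple _) tensor_pow Q s s' * _) ^+ 2)).
rewrite (big_tuple_cons _ _ (fun s => u s ^+ 2)) [RHS]exchange_big /=.
under [RHS]eq_bigr => s _ do
  rewrite -(sum_sqr_orthogonal (fun k => u (k :: s)) QQ).
rewrite [RHS]exchange_big /=; apply: eq_bigr => i _.
rewrite -(IH (fun s => \sum_(k < d) Q i k * u (k :: s))).
apply: eq_bigr => s _; congr (_ ^+ 2).
rewrite (big_tuple_cons _ _ (fun s' => tensor_pow Q (i :: s) s' * u s')).
rewrite exchange_big /=; apply: eq_bigr => s' _; rewrite mulr_sumr.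
by apply: eq_bigr => k _; rewrite mulrCA mulrA.
Qed.

End Rotation.

(** * Derivatives of functions of the norm *)

Section RadialDerivative.
Variable R : realType.

(** The derivatives are existentially quantified, so that closure properties
    need no formula for the higher derivatives of a quotient. *)
Fixpoint derivable_upto (m : nat) (A : set R) (h : R -> R) : Prop :=
  if m is p.+1 then
    exists2 h', (forall r, A r -> is_derive r 1 h (h' r))
      & derivable_upto p A h'
  else True.

Lemma derivable_uptoW m A h : derivable_upto m.+1 A h -> derivable_upto m A h.
Proof. by elim: m h => // m IH h [h' dh /IH]; exists h'. Qed.

Lemma derivable_uptoB m A h1 h2 : derivable_upto m A h1 ->
  derivable_upto m A h2 -> derivable_upto m A (fun r => h1 r - h2 r).
Proof.
elim: m h1 h2 => //= m IH h1 h2 [h1' d1 s1] [h2' d2 s2].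
exists (fun r => h1' r - h2' r); last exact: IH.
by move=> r Ar; apply: is_deriveB; [exact: d1 | exact: d2].
Qed.

(** The derivative [h'/r - h/r/r] is made of quotients by [r] again, which lets
    the induction run over all [h] at once. *)
Lemma derivable_upto_div m A h : ~ A 0 ->
  derivable_upto m A h -> derivable_upto m A (fun r => h r / r).
Proof.
move=> A0; elim: m h => //= m IH h [h' dh sh'].
exists (fun r => h' r / r - h r / r / r); last first.
  apply: derivable_uptoB; first exact: IH.
  by apply/IH/IH/derivable_uptoW; exists h'.
move=> r Ar; have r0 : r != 0 by apply/eqP => r0; apply: A0; rewrite -r0.
have := is_deriveM (dh r Ar) (@is_deriveV _ id r 1 1 r0 (is_derive_id _ _)).
by move=> /is_derive_eq; apply; rewrite /GRing.scale /=; field.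
Qed.

Lemma derivable_upto_eq m A h1 h2 : open A -> {in A, h1 =1 h2} ->
  derivable_upto m A h1 -> derivable_upto m A h2.
Proof.
case: m => //= m oA e [h' dh s]; exists h' => // r Ar.
apply: near_eq_is_derive (dh r Ar).
by apply: filterS (open_nbhs_nbhs (conj oA Ar)) => y Ay; apply: e; rewrite inE.
Qed.

Lemma derivable_upto_D_op m A h : open A -> ~ A 0 ->
  derivable_upto m.+1 A h -> derivable_upto m A (D_op h).
Proof.
move=> oA A0 [h' dh sh']; have := derivable_upto_div A0 sh'.
apply: derivable_upto_eq => // r; rewrite inE => Ar.
rewrite /D_op; case: eqP => [r0|_]; first by case: A0; rewrite -r0.
by rewrite derive1E (@derive_val _ _ _ _ _ _ _ (dh r Ar)).
Qed.

Lemma derivable_iter_D_op A g k r : open A -> ~ A 0 ->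
  (forall m, derivable_upto m A g) -> A r -> derivable (iter k (@D_op R) g) r 1.
Proof.
move=> oA A0 sg Ar.
suff [h' dh _] : derivable_upto 1 A (iter k (@D_op R) g) by have [] := dh r Ar.
elim: k 1%N => [|k IH] m; first exact: sg.
exact: derivable_upto_D_op (IH _).
Qed.

Lemma is_derive_line (V W : normedModType R) (f : V -> W) x v df :
  is_derive x v f df <-> is_derive (0 : R) 1 (fun h : R => f (h *: v + x)) df.
Proof.
have e : 'D_v f x = 'D_1 (fun h : R => f (h *: v + x)) 0.
  rewrite /derive; set g1 := fun h => h^-1 *: _; set g2 := fun h => h^-1 *: _.
  suff -> : g1 = g2 by []; apply/funext => h; rewrite /g1 /g2 /=.
  by rewrite addr0 scale0r add0r [_%:A]mulr1.
split=> -[dfx <-].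
  by apply: DeriveDef; [exact/(derivable1P f x v) | rewrite -e].
by apply: DeriveDef; [exact/(derivable1P f x v) | rewrite e].
Qed.

Lemma is_derive_comp1 (V : normedModType R) (u : V -> R) (h : R -> R)
    x v du dh :
  is_derive (u x) 1 h dh -> is_derive x v u du ->
  is_derive x v (h \o u) (dh * du).
Proof.
move=> hh /is_derive_line hu; apply/is_derive_line.
have -> : (fun t : R => (h \o u) (t *: v + x)) = h \o (fun t => u (t *: v + x)).
  by [].
by apply: is_derive1_comp => //; rewrite scale0r add0r.
Qed.

Variable d : nat.

Lemma is_derive_enorm_sqr (x v : 'rV[R]_d) :
  is_derive x v (fun y : 'rV[R]_d => \sum_(i < d) y 0 i ^+ 2)
    (2 * \sum_(i < d) v 0 i * x 0 i).
Proof.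
have H i := is_deriveM (is_derive_coord x v i) (is_derive_coord x v i).
have := is_derive_sum H; rewrite fct_sumE => /is_derive_eq; apply.
by rewrite mulr_sumr; apply: eq_bigr => i _; rewrite /GRing.scale /=; ring.
Qed.

Lemma is_derive_enorm (x v : 'rV[R]_d) : x != 0 ->
  is_derive x v (@enorm R d) ((\sum_(i < d) v 0 i * x 0 i) / enorm x).
Proof.
move=> x0; have e0 : enorm x != 0 by rewrite enorm_eq0.
have pos : 0 < \sum_(i < d) x 0 i ^+ 2.
  by rewrite -enorm_sqr lt_def sqrf_eq0 e0 sqr_ge0.
have := is_derive_comp1 (is_derive1_sqrt pos) (is_derive_enorm_sqr x v).
move=> /is_derive_eq; apply; rewrite -/(enorm x); field; exact: e0.
Qed.

(** The derivative of [r] along [v] is [(v . x) / r], and the division by [r]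
    is what turns [h'] into [D h]. *)
Lemma is_derive_radial (h : R -> R) (x v : 'rV[R]_d) : x != 0 ->
  derivable h (enorm x) 1 ->
  is_derive x v (fun y => h (enorm y))
    ((\sum_(i < d) v 0 i * x 0 i) * D_op h (enorm x)).
Proof.
move=> x0 /derivableP dh.
have := is_derive_comp1 dh (is_derive_enorm v x0) => /is_derive_eq; apply.
by rewrite /D_op enorm_eq0 (negbTE x0) derive1E; ring.
Qed.

Lemma enorm_continuous : continuous (@enorm R d).
Proof.
move=> x; apply: (@continuous_comp _ _ _
  (fun y : 'rV[R]_d => \sum_(i < d) y 0 i ^+ 2)).
  move: x; apply: continuous_big => [|i _ x]; first exact: add_continuous.
  apply: (@continuous_comp _ _ _ (fun y : 'rV[R]_d => y 0 i) (fun r => r ^+ 2)).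
    exact: coord_continuous.
  exact: exprn_continuous.
exact: sqrt_continuous.
Qed.

End RadialDerivative.

(** * Partial derivatives of a radial function *)

Section RadialPartials.
Variables (R : realType) (d : nat).

Lemma is_derive_sum_seq (V W : normedModType R) (I : Type) (r : seq I)
    (h : I -> V -> W) x v dh :
  (forall i, is_derive x v (h i) (dh i)) ->
  is_derive x v (fun y => \sum_(i <- r) h i y) (\sum_(i <- r) dh i).
Proof.
move=> hd; elim: r => [|i r IH].
  by rewrite big_nil; under eq_fun do rewrite big_nil; exact: is_derive_cst.
by rewrite big_cons; under eq_fun do rewrite big_cons; exact: is_deriveD.
Qed.

Lemma is_derive_mulmx (h : 'rV[R]_d -> R) (Q : 'M[R]_d) x v dh :
  is_derive (x *m Q) (v *m Q) h dh -> is_derive x v (fun y => h (y *m Q)) dh.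
Proof.
move=> /is_derive_line dh'; apply/is_derive_line.
by under eq_fun do rewrite mulmxDl -scalemxAl.
Qed.

Lemma is_derive_axis (h : 'rV[R]_d -> R) (i : 'I_d) t dh :
  is_derive (t *: delta_mx 0 i) (delta_mx 0 i) h dh ->
  is_derive t 1 (fun y => h (y *: delta_mx 0 i)) dh.
Proof.
move=> /is_derive_line dh'; apply/is_derive_line.
by under eq_fun do rewrite [_%:A]mulr1 scalerDl.
Qed.

Lemma sum_delta_mx (a : 'I_d -> R) (i : 'I_d) :
  \sum_(k < d) (delta_mx 0 i : 'rV[R]_d) 0 k * a k = a i.
Proof.
rewrite (bigD1 i) //= big1 ?addr0 => [|k /negbTE ki].
  by rewrite mxE !eqxx mul1r.
by rewrite mxE ki andbF mul0r.
Qed.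

Variable rho : \bar R.

Definition radii : set R := [set r | 0 < r /\ (r%:E < rho)%E].

Lemma open_lt_ereal : open [set r : R | (r%:E < rho)%E].
Proof.
case: rho => [b| |].
- by rewrite (_ : [set r | _] = [set r | r < b]) //; exact: open_lt.
- rewrite (_ : [set r | _] = setT); [exact: openT|].
  by apply/seteqP; split => // r _ /=; exact: ltry.
- by rewrite (_ : [set r | _] = set0); [exact: open0 | apply/seteqP; split].
Qed.

Lemma open_radii : open radii.
Proof.
apply: openI; [exact: open_gt | exact: open_lt_ereal].
Qed.

Lemma radii_enorm (x : 'rV[R]_d) :
  radii (enorm x) <-> eball rho x /\ x != 0.
Proof.
rewrite /radii /eball /= lt_def enorm_ge0 andbT enorm_eq0.
by split=> -[].
Qed.

Lemma near_punctured (x : 'rV[R]_d) : eball rho x -> x != 0 ->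
  \forall y \near x, eball rho y /\ y != 0.
Proof.
move=> bx x0; have /radii_enorm Ax := conj bx x0.
have nA : nbhs (enorm x) radii.
  by apply: open_nbhs_nbhs; split=> //; exact: open_radii.
near=> y; apply/radii_enorm; near: y.
exact: (@enorm_continuous R d x _ nA).
Unshelve. all: by end_near. Qed.

Variables (f : 'rV[R]_d -> R) (g : R -> R).
Hypothesis hsmooth : smooth_on_ball rho f.
Hypothesis hradial : forall x, eball rho x -> f x = g (enorm x).

Lemma eball_axis t (i : 'I_d) : (`|t|%:E < rho)%E ->
  eball rho (t *: delta_mx 0 i : 'rV[R]_d).
Proof. by rewrite /eball /= enorm_axis. Qed.

Lemma is_derive_partials_axis s (i : 'I_d) (t : R) : (`|t|%:E < rho)%E ->
  is_derive t 1 (fun y => partials s f (y *: delta_mx 0 i))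
    (partials (i :: s) f (t *: delta_mx 0 i)).
Proof.
move=> tr; apply: is_derive_axis; apply: derivableP.
by have [_] := hsmooth s (eball_axis i tr).
Qed.

(** On [radii], the function [g] is the restriction of [f] to an axis, all of
    whose iterated partial derivatives exist. *)
Lemma profile_derivable m (i : 'I_d) : derivable_upto m radii g.
Proof.
have H s : derivable_upto m radii (fun y => partials s f (y *: delta_mx 0 i)).
  elim: m s => //= m IH s.
  exists (fun y => partials (i :: s) f (y *: delta_mx 0 i)) => //.
  by move=> r [r0 rr]; apply: is_derive_partials_axis; rewrite gtr0_norm.
apply: derivable_upto_eq (H [::]); first exact: open_radii.
move=> r; rewrite inE => -[r0 rr] /=.
rewrite hradial ?enorm_axis ?gtr0_norm //.
by apply: eball_axis; rewrite gtr0_norm.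
Qed.

Lemma iter_D_op_derivable k r : (0 < d)%N -> radii r ->
  derivable (iter k (@D_op R) g) r 1.
Proof.
move=> d0; apply: derivable_iter_D_op open_radii _ _.
  by move=> [] /=; rewrite ltxx.
by move=> m; exact: profile_derivable (Ordinal d0).
Qed.

(** The sequence that the powers of the formal variable are paired with. *)
Definition radial_jet (x : 'rV[R]_d) (k : nat) : R :=
  iter k (@D_op R) g (enorm x).

Lemma is_derive_radial_jet (x v : 'rV[R]_d) (c : 'I_d -> nat) :
  eball rho x -> x != 0 ->
  is_derive x v
    (fun y => pairing (\prod_(i < d) hermite (y 0 i) (c i)) (radial_jet y))
    (\sum_(i < d) v 0 i *
       pairing (\prod_(k < d) hermite (x 0 k) (incr i c k)) (radial_jet x)).
Proof.
move=> bx x0; apply: is_derive_hermite_prod => k.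
apply: is_derive_radial => //.
apply: iter_D_op_derivable; last exact/radii_enorm.
by case: d x x0 {bx v c} => // x; rewrite [x]thinmx0 eqxx.
Qed.

Lemma partials_radial s (x : 'rV[R]_d) : eball rho x -> x != 0 ->
  partials s f x =
  pairing (\prod_(i < d) hermite (x 0 i) (counts s i)) (radial_jet x).
Proof.
elim: s x => [|i s IH] x bx x0.
  rewrite big1 // -(expr0 'X) pairingXn; exact: hradial.
have near_IH : {near x, (fun y : 'rV[R]_d =>
    pairing (\prod_(k < d) hermite (y 0 k) (counts s k)) (radial_jet y)) =1
    partials s f}.
  by apply: filterS (near_punctured bx x0) => y [by_ y0]; rewrite IH.
have e := near_eq_is_derive near_IH
  (is_derive_radial_jet (delta_mx 0 i) (counts s) bx x0).
by rewrite [LHS](@derive_val _ _ _ _ _ _ _ e) sum_delta_mx.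
Qed.

(** Linearity of the directional derivative in [v], read off from the explicit
    form of the partial derivatives. *)
Lemma is_derive_partials s (x v : 'rV[R]_d) : eball rho x -> x != 0 ->
  is_derive x v (partials s f) (\sum_(i < d) v 0 i * partials (i :: s) f x).
Proof.
move=> bx x0; have := is_derive_radial_jet v (counts s) bx x0.
move=> /(@near_eq_is_derive _ _ _ _ (partials s f)) H.
apply: is_derive_eq (H _) _.
  apply: filterS (near_punctured bx x0) => y [by_ y0].
  by rewrite partials_radial.
by apply: eq_bigr => i _; rewrite partials_radial.
Qed.

(** The chain rule for [x |-> x *m Q], iterated, applied to [f = f o Q]. *)
Lemma partials_rotate (Q : 'M[R]_d) s (x : 'rV[R]_d) :
  Q^T *m Q = 1%:M -> eball rho x -> x != 0 ->
  partials s f x = \sum_(s' : (size s).-tuple 'I_d)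
    tensor_pow Q s s' * partials s' f (x *m Q).
Proof.
move=> QQ.
have ball_rot (y : 'rV[R]_d) : eball rho y -> eball rho (y *m Q).
  by rewrite /eball /= enorm_orthogonal.
have rot_neq0 (y : 'rV[R]_d) : y != 0 -> y *m Q != 0.
  by rewrite -!enorm_eq0 enorm_orthogonal.
elim: s x => [|i s IH] x bx x0.
  rewrite (big_tuple0 _
    (fun s' => tensor_pow Q [::] s' * partials s' f (x *m Q))) mul1r /=.
  by rewrite hradial // hradial ?enorm_orthogonal //; exact: ball_rot.
have e (s' : (size s).-tuple 'I_d) := is_derive_mulmx
  (is_derive_partials s' (delta_mx 0 i *m Q) (ball_rot _ bx) (rot_neq0 _ x0)).
have e' (s' : (size s).-tuple 'I_d) := is_deriveZ (tensor_pow Q s s') (e s').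
have near_IH : {near x, (fun y : 'rV[R]_d => \sum_(s' : (size s).-tuple 'I_d)
    tensor_pow Q s s' * partials s' f (y *m Q)) =1 partials s f}.
  by apply: filterS (near_punctured bx x0) => y [by_ y0]; rewrite IH.
have e2 := near_eq_is_derive near_IH (is_derive_sum_seq (index_enum _) e').
rewrite [LHS](@derive_val _ _ _ _ _ _ _ e2).
rewrite (big_tuple_cons _ _ (fun s' =>
  tensor_pow Q (i :: s) s' * partials s' f (x *m Q))).
rewrite exchange_big /=; apply: eq_bigr => s' _.
rewrite /GRing.scale /= mulr_sumr; apply: eq_bigr => k _.
by rewrite -rowE mxE mulrCA mulrA.
Qed.

(** A reflection that sends [x] to the axis acts isometrically on the tensor of
    derivatives; the origin already lies on the axis. *)
Lemma S_op_axis n (x : 'rV[R]_d) (i : 'I_d) : eball rho x ->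
  S_op n f x = S_op n f (enorm x *: delta_mx 0 i).
Proof.
move=> bx; have [->|x0] := eqVneq x 0.
  congr S_op; apply/esym/eqP.
  by rewrite -enorm_eq0 enorm_axis normr_eq0 enorm_eq0.
have [Q QQ <-] := orthogonal_to_axis x i.
rewrite /S_op -(sum_sqr_tensor_pow _ (fun s => partials s f (x *m Q)) QQ).
apply: eq_bigr => s _; congr (_ ^+ 2).
by rewrite (partials_rotate s QQ bx x0) size_tuple.
Qed.

End RadialPartials.

(** * Values on a coordinate axis *)

Section Axis.
Variables (R : realType) (d : nat).

(** The exponent of ['X], that is the number of applications of [D], produced on
    the axis [i0] by the other indices. *)
Definition half_sum (i0 : 'I_d) (c : 'I_d -> nat) : nat :=
  (\sum_(i < d | i != i0) (c i)./2)%N.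

Lemma prod_hermite_axis (i0 : 'I_d) (t : R) c :
  \prod_(i < d) hermite ((t *: delta_mx 0 i0 : 'rV[R]_d) 0 i) (c i) =
  (weight i0 c)%:R *: (hermite t (c i0) * 'X^(half_sum i0 c)).
Proof.
rewrite (bigD1 i0) //= !mxE !eqxx mulr1 [RHS]scalerAr; congr (_ * _).
rewrite (eq_bigr (fun i => (matchings (c i))%:R *: 'X^((c i)./2)));
  last move=> i /negbTE ne.
  by rewrite scaler_prod -natr_prod -expr_sum.
by rewrite !mxE ne andbF mulr0 hermite_at0.
Qed.

(** As [matchings] vanishes on odd numbers, no half is rounded in [half_sum]. *)
Lemma weight_parity (i0 : 'I_d) c : weight i0 c != 0%N ->
  (\sum_(i < d) c i = c i0 + 2 * half_sum i0 c)%N.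
Proof.
move=> w0; rewrite (bigD1 i0) //= big_distrr; congr (_ + _)%N.
apply: eq_bigr => i ne /=; move: w0; rewrite /weight (bigD1 i) //= muln_eq0.
rewrite negb_or => /andP[+ _]; rewrite /matchings.
by case: ifP => // oc _; rewrite mul2n -[LHS]odd_double_half oc.
Qed.

Lemma odd_dfact_neq0 j : (odd_dfact j)%:R != 0 :> R.
Proof.
by rewrite pnatr_eq0 -lt0n prodn_gt0 // => i; rewrite addn1.
Qed.

Lemma matchings_double j : matchings (2 * j) = odd_dfact j.
Proof. by rewrite /matchings mul2n odd_double doubleK. Qed.

(** Lets the explicit formulas, which hold for [t <> 0], reach the origin. *)
Lemma eq_at0 (a b : R -> R) : {for 0, continuous a} -> {for 0, continuous b} ->
  (\forall t \near 0^', a t = b t) -> a 0 = b 0.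
Proof.
move=> /continuous_withinNx ca /continuous_withinNx cb e.
apply: cvg_unique ca _; first exact: Rhausdorff.
by apply: cvg_trans cb; apply: near_eq_cvg; apply: filterS e => t.
Qed.

Variables (rho : \bar R) (f : 'rV[R]_d -> R) (g : R -> R).
Hypothesis hsmooth : smooth_on_ball rho f.
Hypothesis hradial : forall x, eball rho x -> f x = g (enorm x).
Variable i0 : 'I_d.
Hypothesis hprofile :
  forall t : R, (`|t|%:E < rho)%E -> g t = f (t *: delta_mx 0 i0).

Lemma near_lt_rho (t : R) : (`|t|%:E < rho)%E ->
  \forall y \near t, (`|y|%:E < rho)%E.
Proof.
move=> tr; have n : nbhs `|t| [set r : R | (r%:E < rho)%E].
  by apply: open_nbhs_nbhs; split=> //; exact: open_lt_ereal.
near=> y; near: y; exact: (@norm_continuous _ _ t _ n).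
Unshelve. all: by end_near. Qed.

(** [D] preserves evenness.  The explicit form of the partial derivatives only
    knows [D^k g] at [enorm x], while the derivatives of [D^k g] at [0] also see
    negative arguments. *)
Lemma iter_D_op_even k (t : R) : (`|t|%:E < rho)%E ->
  iter k (@D_op R) g (- t) = iter k (@D_op R) g t.
Proof.
elim: k t => [|k IH] t tr /=.
  have e (y : R) : (`|y|%:E < rho)%E -> g y = g `|y|.
    by move=> yr; rewrite hprofile // hradial ?enorm_axis //; exact: eball_axis.
  by rewrite e ?normrN // -e.
wlog t0 : t tr / 0 < t.
  move=> H; have [/H|t0|<-] := ltgtP 0 t; [exact| |by rewrite oppr0].
  by rewrite -(H (- t)) ?opprK ?normrN // oppr_gt0.
have d0 : (0 < d)%N by case: d i0 => [[]|].
have dt : derivable (iter k (@D_op R) g) t 1.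
  apply: (iter_D_op_derivable hsmooth hradial d0).
  by split=> //; rewrite -(gtr0_norm t0).
set h := iter k _ g in IH dt *.
have dN : is_derive (- t) 1 (h \o -%R) ('D_1 h t * (- 1)).
  apply: is_derive1_comp; rewrite ?opprK; first exact: derivableP.
have near_h : \forall y \near - t, (h \o -%R) y = h y.
  have /near_lt_rho : (`|- t|%:E < rho)%E by rewrite normrN.
  by apply: filterS => y yr /=; exact: IH.
rewrite /D_op oppr_eq0 gt_eqF // !derive1E.
rewrite (@derive_val _ _ _ _ _ _ _ (near_eq_is_derive near_h dN)).
by rewrite mulrN1 invrN mulrNN.
Qed.

Lemma iter_D_op_norm k (t : R) : (`|t|%:E < rho)%E ->
  iter k (@D_op R) g `|t| = iter k (@D_op R) g t.
Proof. by move=> tr; case: ger0P => // _; exact: iter_D_op_even. Qed.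

Lemma partials_axis_continuous s (i : 'I_d) (t : R) : (`|t|%:E < rho)%E ->
  {for t, continuous (fun y : R => partials s f (y *: delta_mx 0 i))}.
Proof.
move=> tr; apply/differentiable_continuous/derivable1_diffP.
by have [] := is_derive_partials_axis hsmooth s i tr.
Qed.

Lemma partials_axis_neq0 s (t : R) : (`|t|%:E < rho)%E -> t != 0 ->
  partials s f (t *: delta_mx 0 i0) = (weight i0 (counts s))%:R *
    pairing (hermite t (counts s i0) * 'X^(half_sum i0 (counts s)))
      (fun k => iter k (@D_op R) g `|t|).
Proof.
move=> tr t0; rewrite (partials_radial hsmooth hradial); last 2 first.
- exact: eball_axis.
- by rewrite -enorm_eq0 enorm_axis normr_eq0.
by rewrite prod_hermite_axis pairingZ /radial_jet enorm_axis.
Qed.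

Variable i1 : 'I_d.
Hypothesis i1i0 : i1 != i0.

(** The words made of [i0] and one further index [i1] represent all the
    derivatives of all the [D^j g]. *)
Lemma counts_block m p :
  let c := counts (nseq m i0 ++ nseq p i1) in
  [/\ c i0 = m, weight i0 c = matchings p & half_sum i0 c = p./2].
Proof.
have cE i : counts (nseq m i0 ++ nseq p i1) i =
    ((i0 == i) * m + (i1 == i) * p)%N.
  by rewrite /counts count_cat !count_nseq.
split.
- by rewrite cE eqxx (negbTE i1i0) mul1n addn0.
- rewrite /weight (bigD1 i1) //= big1 => [|i /andP[]].
    by rewrite cE eqxx eq_sym (negbTE i1i0) mul1n muln1.
  rewrite cE ![i == _]eq_sym => /negbTE -> /negbTE ->.
  by rewrite /matchings /odd_dfact big_ord0.
- rewrite /half_sum (bigD1 i1) //= big1 => [|i /andP[]].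
    by rewrite cE eqxx eq_sym (negbTE i1i0) mul1n addn0.
  by rewrite cE ![i == _]eq_sym => /negbTE -> /negbTE ->.
Qed.

(** For [t <> 0] this is [H_(2j)(0) = (2j-1)!! X^j].  At [0], the left-hand
    side is a limit of its values at [t <> 0], and the right-hand side is
    continuous; in particular the limit exists. *)
Lemma iter_D_op_partials j (t : R) : (`|t|%:E < rho)%E ->
  iter j (@D_op R) g t =
  (odd_dfact j)%:R^-1 * partials (nseq (2 * j) i1) f (t *: delta_mx 0 i0).
Proof.
have off0 k y : (`|y|%:E < rho)%E -> y != 0 -> iter k (@D_op R) g y =
    (odd_dfact k)%:R^-1 * partials (nseq (2 * k) i1) f (y *: delta_mx 0 i0).
  move=> yr y0; have [/= c0 w h] := counts_block 0 (2 * k).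
  rewrite partials_axis_neq0 // c0 w h matchings_double.
  rewrite mulKf ?odd_dfact_neq0 //.
  by rewrite mul1r mul2n doubleK pairingXn iter_D_op_norm.
move=> tr; have [t0|] := eqVneq t 0; last exact: off0.
rewrite {t}t0 in tr *; case: j => [|j].
  by rewrite /odd_dfact big_ord0 invr1 mul1r /= hprofile.
rewrite [LHS]/= [LHS]/D_op eqxx; apply/cvg_lim; first exact: Rhausdorff.
have cont : {for (0 : R), continuous (fun t : R => (odd_dfact j.+1)%:R^-1 *
    partials (nseq (2 * j.+1) i1) f (t *: delta_mx 0 i0))}.
  apply: continuousM; first exact: cst_continuous.
  exact: partials_axis_continuous.
move/continuous_withinNx: cont; apply: cvg_trans; apply: near_eq_cvg.
near=> t.
have tne0 : t != 0 by near: t; exact: nbhs_dnbhs_neq.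
have tr' : (`|t|%:E < rho)%E by near: t; apply: nbhs_dnbhs; exact: near_lt_rho.
by rewrite -off0 //= /D_op (negbTE tne0).
Unshelve. all: by end_near. Qed.

Lemma derive1n_iter_D_op m j (t : R) : (`|t|%:E < rho)%E ->
  derive1n m (iter j (@D_op R) g) t = (odd_dfact j)%:R^-1 *
    partials (nseq m i0 ++ nseq (2 * j) i1) f (t *: delta_mx 0 i0).
Proof.
elim: m t => [|m IH] t tr; first exact: iter_D_op_partials.
have near_IH : {near t, (fun y : R => (odd_dfact j)%:R^-1 *
    partials (nseq m i0 ++ nseq (2 * j) i1) f (y *: delta_mx 0 i0)) =1
    derive1n m (iter j (@D_op R) g)}.
  by apply: filterS (near_lt_rho tr) => y yr; rewrite IH.
have d1 := is_derive_partials_axis hsmooth (nseq m i0 ++ nseq (2 * j) i1) i0 tr.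
have d2 := near_eq_is_derive near_IH (is_deriveZ (odd_dfact j)%:R^-1 d1).
by rewrite derive1nS derive1E (@derive_val _ _ _ _ _ _ _ d2).
Qed.

(** Both sides are explicit for [t <> 0].  At [0], the right-hand side is first
    rewritten as a partial derivative, whose continuity is available. *)
Lemma partials_axis s (t : R) : (`|t|%:E < rho)%E ->
  partials s f (t *: delta_mx 0 i0) = (weight i0 (counts s))%:R *
    derive1n (counts s i0) (iter (half_sum i0 (counts s)) (@D_op R) g) t.
Proof.
move=> tr; rewrite derive1n_iter_D_op //.
set b := nseq _ _ ++ nseq _ _.
have off0 y : (`|y|%:E < rho)%E -> y != 0 ->
    partials s f (y *: delta_mx 0 i0) = (weight i0 (counts s))%:R *
      ((odd_dfact (half_sum i0 (counts s)))%:R^-1 *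
       partials b f (y *: delta_mx 0 i0)).
  move=> yr y0; rewrite !partials_axis_neq0 //.
  have [/= -> -> ->] := counts_block (counts s i0) (2 * half_sum i0 (counts s)).
  by rewrite matchings_double mulKf ?odd_dfact_neq0 // mul2n doubleK.
have [t0|] := eqVneq t 0; last exact: off0.
rewrite {t}t0 in tr *.
apply: (@eq_at0 (fun y => partials s f (y *: delta_mx 0 i0))
  (fun y => (weight i0 (counts s))%:R *
    ((odd_dfact (half_sum i0 (counts s)))%:R^-1 *
     partials b f (y *: delta_mx 0 i0)))).
- exact: partials_axis_continuous.
- apply: continuousM; first exact: cst_continuous.
  apply: continuousM; first exact: cst_continuous.
  exact: partials_axis_continuous.
near=> y; apply: off0; near: y; last exact: nbhs_dnbhs_neq.
by apply: nbhs_dnbhs; exact: near_lt_rho.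
Unshelve. all: by end_near. Qed.

(** A word of nonzero weight contributes to exactly one [j], the one for which
    it contains the axis index [n - 2j] times. *)
Lemma S_op_on_axis n (t : R) : (`|t|%:E < rho)%E ->
  S_op n f (t *: delta_mx 0 i0) = T_op d n g t.
Proof.
move=> tr; pose A j := derive1n (n - 2 * j) (iter j (@D_op R) g) t ^+ 2.
transitivity (\sum_(s : n.-tuple 'I_d) \sum_(j < n./2.+1)
    ((counts s i0 == n - 2 * j) * weight i0 (counts s) ^ 2)%N%:R * A j).
  apply: eq_bigr => s _; rewrite partials_axis //.
  have [->|/weight_parity] := eqVneq (weight i0 (counts s)) 0%N.
    by rewrite mul0r expr0n big1 // => j _; rewrite exp0n // muln0 mul0r.
  rewrite sum_counts size_tuple; move: (half_sum _ _) => J nE.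
  have Jn : (J < n./2.+1)%N by lia.
  have c0 : counts s i0 = (n - 2 * J)%N by lia.
  rewrite (bigD1 (Ordinal Jn)) //= big1 ?addr0 => [|j jJ].
    by rewrite c0 eqxx mul1n natrX exprMn.
  rewrite c0; case: eqP => [e|_]; last by rewrite mul0n mul0r.
  by case/eqP: jJ; apply/val_inj => /=; have := ltn_ord j; lia.
rewrite exchange_big /=; apply: eq_bigr => j _.
rewrite -mulr_suml -natr_sum; congr (_%:R * _).
by apply: sum_weight_alpha; rewrite -ltnS.
Qed.

End Axis.

(** * The squared norm as a function of the radius *)

Unset Implicit Arguments.
Set Strict Implicit.
Set Printing Implicit Defensive.

Theorem theorem1 (R : realType) (n d : nat) (hn : (1 <= n)%N) (hd : (2 <= d)%N)
    (rho : \bar R) (hrho : (0 < rho)%E) (f : 'rV[R]_d -> R) (g : R -> R)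
    (hsmooth : smooth_on_ball rho f)
    (hradial : forall x, eball rho x -> f x = g (enorm x))
    (hprofile : radial_profile rho f g) :
  [/\ alpha d n 0 = 1%N,
      forall j : nat, (j <= n./2)%N -> (0 < alpha d n j)%N,
      radial_on_ball rho (S_op n f) &
      forall x, eball rho x -> S_op n f x = T_op d n g (enorm x)].
Proof.
have d0 : (0 < d)%N by exact: ltn_trans hd.
have identity x : eball rho x -> S_op n f x = T_op d n g (enorm x).
  pose i0 := Ordinal d0; pose i1 := Ordinal hd.
  have profile t : (`|t|%:E < rho)%E -> g t = f (t *: delta_mx 0 i0).
    move=> tr; rewrite hprofile //; congr (f (_ *: _)).
    by apply/rowP => j; rewrite !mxE.
  move=> bx; rewrite (S_op_axis hsmooth hradial n i0 bx).
  apply: (S_op_on_axis hsmooth hradial profile (i1 := i1)) => //.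
  by rewrite ger0_norm ?enorm_ge0.
split=> //.
- by rewrite /alpha muln0 bin0 /odd_dfact !big_ord0.
- move=> j jn; rewrite /alpha !muln_gt0 bin_gt0 -andbA; apply/and3P; split.
  + lia.
  + by rewrite /odd_dfact prodn_gt0 // => i; rewrite addn1.
  + by rewrite prodn_gt0 // => i; rewrite addn_gt0 subn_gt0 hd.
- by exists (T_op d n g).
Qed.
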